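(* Let $(S,P)$ be a $\Gamma$-contraction on a Hilbert space $\mathcal{H}$, let $F\in\mathcal{B}(\mathcal{D}_P)$ and $G\in\mathcal{B}(\mathcal{D}_{P^*})$ be the fundamental operators of $(S,P)$ and $(S^*,P^* )$ respectively, and let $(R,U)$ be the $\Gamma$-unitary dilation of $(S,P)$ on $\mathcal{K}=\mathcal{H}\oplus l^2(\mathcal{D}_P)\oplus l^2(\mathcal{D}_{P^*})$ given, for $h\in\mathcal{H}$, $a=(a_0,a_1,\dots)\in l^2(\mathcal{D}_P)$, $b=(b_0,b_1,\dots)\in l^2(\mathcal{D}_{P^*})$, by $$U(h\oplus a\oplus b)=(Ph+D_{P^*}b_0)\oplus(D_Ph-P^*b_0,\,a_0,\,a_1,\,a_2,\dots)\oplus(b_1,b_2,b_3,\dots),$$ $$R(h\oplus a\oplus b)=(Sh+D_{P^*}Gb_0)\oplus(F^*D_Ph+Fa_0-P^*Gb_0,\,F^*a_0+Fa_1,\,F^*a_1+Fa_2,\dots)\oplus(G^*b_0+Gb_1,\,G^*b_1+Gb_2,\dots).$$ Then the dilation $(R,U)$ of $(S,P)$ is minimal. Indeed, $$\overline{\mathrm{span}}\{R^{m_1}R^{*m_2}U^nh:h\in\mathcal{H},\ m_1,m_2\in\mathbb{N},\ n\in\mathbb{Z}\}=\overline{\mathrm{span}}\{U^nh:h\in\mathcal{H},\ n\in\mathbb{Z}\}.$$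
   Context: Let $\Gamma=\{(z_1+z_2,z_1z_2):|z_1|\le 1,|z_2|\le 1\}$ and $b\Gamma=\{(z_1+z_2,z_1z_2):|z_1|=|z_2|=1\}$. A $\Gamma$-contraction is a commuting pair $(S,P)$ of bounded operators on a Hilbert space with $\|f(S,P)\|\le\sup\{|f(s,p)|:(s,p)\in\Gamma\}$ for every polynomial $f$ in two variables. Then $P$ is a contraction and $(S^*,P^* )$ is also a $\Gamma$-contraction. A $\Gamma$-unitary is a commuting pair $(R,U)$ of bounded normal operators with joint spectrum $\sigma(R,U)\subset b\Gamma$. A $\Gamma$-unitary dilation of $(S,P)$ is a $\Gamma$-unitary $(R,U)$ on a Hilbert space $\mathcal{K}\supset\mathcal{H}$ with $S^mP^n=P_{\mathcal{H}}R^mU^n|_{\mathcal{H}}$ for all integers $m,n\ge 0$. For a contraction $P$: $D_P=(I-P^*P)^{1/2}$, $\mathcal{D}_P=\overline{\mathrm{Ran}}\,D_P$, $D_{P^*}=(I-PP^* )^{1/2}$, $\mathcal{D}_{P^*}=\overline{\mathrm{Ran}}\,D_{P^*}$; $l^2(\mathcal{D})=\mathcal{D}\oplus\mathcal{D}\oplus\cdots$. The space $\mathcal{H}$ is embedded in $\mathcal{K}$ by $h\mapsto h\oplus 0\oplus 0$. The fundamental operator of a $\Gamma$-contraction $(S,P)$ is the unique operator $F\in\mathcal{B}(\mathcal{D}_P)$ satisfying $S-S^*P=D_PFD_P$ (it is known that such an $F$ exists and is unique); accordingly the fundamental operator $G\in\mathcal{B}(\mathcal{D}_{P^*})$ of $(S^*,P^*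 )$ is the unique operator with $S^*-SP^*=D_{P^*}GD_{P^*}$. A commuting normal dilation $(N_1,\dots,N_d)$ on $\mathcal{K}$ of a commuting tuple on $\mathcal{H}\subset\mathcal{K}$ is minimal if $\mathcal{K}=\overline{\mathrm{span}}\{N_1^{k_1}\cdots N_d^{k_d}N_1^{*l_1}\cdots N_d^{*l_d}h:h\in\mathcal{H},\ k_i,l_i\in\mathbb{N}\}$. Here $\mathbb{N}$ includes $0$, and $U^n=(U^* )^{|n|}$ for $n<0$. *)

(* Defs.v *)
From HB Require Import structures.
From mathcomp Require Import all_boot all_order all_algebra.
From mathcomp Require Import all_classical all_reals topology normedtype sequences.
From mathcomp Require Import complex ring lra.
Set Implicit Arguments. Unset Strict Implicit. Unset Printing Implicit Defensive.
Import Order.TTheory GRing.Theory Num.Theory.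
Import numFieldNormedType.Exports.
Local Open Scope classical_set_scope.
Local Open Scope ring_scope.

Section InnerTheory.
Variables (R : realType) (V : lmodType R[i]) (inn : V -> V -> R[i]).
Hypothesis innL : forall a x y z, inn (a *: x + y) z = a * inn x z + inn y z.
Hypothesis innC : forall x y, inn y x = (inn x y)^*.
Hypothesis inn_ge0 : forall x, 0 <= inn x x.
Hypothesis inn_eq0 : forall x, inn x x = 0 -> x = 0.

Lemma innDl x y z : inn (x + y) z = inn x z + inn y z.
Proof. by rewrite -[x]scale1r innL mul1r scale1r. Qed.

Lemma inn0l z : inn 0 z = 0.
Proof. by apply: (@addrI _ (inn 0 z)); rewrite -innDl !addr0. Qed.

Lemma innZl a x z : inn (a *: x) z = a * inn x z.
Proof. by rewrite -[a *: x]addr0 innL inn0l addr0. Qed.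

Lemma innDr x y z : inn z (x + y) = inn z x + inn z y.
Proof. by rewrite innC innDl rmorphD /= -!innC. Qed.

Lemma innZr a x z : inn z (a *: x) = a^* * inn z x.
Proof. by rewrite innC innZl rmorphM /= -innC. Qed.

Lemma innNl x z : inn (- x) z = - inn x z.
Proof. by rewrite -scaleN1r innZl mulN1r. Qed.

Lemma innNr x z : inn z (- x) = - inn z x.
Proof. by rewrite innC innNl rmorphN /= -innC. Qed.

Lemma inn_CS x y : `|inn x y| ^+ 2 <= inn x x * inn y y.
Proof.
have [y0|y0] := eqVneq (inn y y) 0.
  by rewrite y0 mulr0 (inn_eq0 y0) [inn x 0]innC inn0l rmorph0 normr0 expr0n.
have yp : 0 < inn y y by rewrite lt_def y0 inn_ge0.
rewrite -ler_pdivrMr //.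
have := inn_ge0 (x - (inn x y / inn y y) *: y).
rewrite innDl !innDr !innNl !innNr !innZl !innZr (innC x y).
rewrite rmorphM fmorphV /= (geC0_conj (inn_ge0 y)) normCK => h.
rewrite -subr_ge0; apply: (le_trans h); rewrite le_eqVlt; apply/orP; left.
by apply/eqP; field.
Qed.

Definition inn_norm x := sqrtC (inn x x).

Lemma inn_norm_ge0 x : 0 <= inn_norm x.
Proof. by rewrite /inn_norm sqrtC_ge0. Qed.

Lemma inn_normZ a x : inn_norm (a *: x) = `|a| * inn_norm x.
Proof.
apply: (@pexpIrn _ 2%N) => //; rewrite ?nnegrE ?mulr_ge0 ?inn_norm_ge0 //.
by rewrite exprMn /inn_norm !sqrtCK innZl innZr mulrA normCK.
Qed.

Lemma inn_norm_eq0 x : inn_norm x = 0 -> x = 0.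
Proof. by move/eqP; rewrite sqrtC_eq0 => /eqP/inn_eq0. Qed.

Lemma inn_CSn x y : `|inn x y| <= inn_norm x * inn_norm y.
Proof.
rewrite -(@ler_pXn2r _ 2%N) ?nnegrE ?mulr_ge0 ?inn_norm_ge0 //.
by rewrite exprMn !sqrtCK inn_CS.
Qed.

Lemma inn_normD x y : inn_norm (x + y) <= inn_norm x + inn_norm y.
Proof.
rewrite -(@ler_pXn2r _ 2%N) ?nnegrE ?addr_ge0 ?inn_norm_ge0 //.
rewrite sqrrD !sqrtCK innDl !innDr (innC x y).
set d := inn x y.
suff : d + d^* <= (inn_norm x * inn_norm y) *+ 2.
  by move=> h; rewrite -addrA [d + _]addrA addrA lerD2r lerD2l.
have dr : d + d^* \is Num.real by rewrite CrealE rmorphD /= conjCK addrC.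
rewrite (le_trans (real_ler_norm dr))// (le_trans (ler_normD _ _))//.
by rewrite norm_conjC mulr2n lerD ?inn_CSn.
Qed.

End InnerTheory.

(* Scalars are R[i]; `|x| is a nonnegative real element of R[i].  The inner
   product is linear in its first argument and conjugate linear in the second. *)
HB.mixin Record hasInner (R : realType) V of NormedModule R[i] V := {
  inner : V -> V -> R[i];
  inner_linear : forall (a : R[i]) x y z,
    inner (a *: x + y) z = a * inner x z + inner y z;
  inner_conj : forall x y, inner y x = (inner x y)^*;
  inner_norm : forall x, inner x x = `|x| ^+ 2 }.

#[short(type="preHilbertType")]
HB.structure Definition PreHilbert (R : realType) :=
  {V of hasInner R V & NormedModule R[i] V}.

#[short(type="hilbertType")]
HB.structure Definition Hilbert (R : realType) :=
  {V of PreHilbert R V & CompleteNormedModule R[i] V}.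

HB.factory Record Lmodule_hasInner (R : realType) V of GRing.Lmodule R[i] V := {
  inn : V -> V -> R[i];
  innL : forall (a : R[i]) x y z, inn (a *: x + y) z = a * inn x z + inn y z;
  innC : forall x y, inn y x = (inn x y)^*;
  inn_ge0 : forall x, 0 <= inn x x;
  inn_eq0 : forall x, inn x x = 0 -> x = 0 }.

HB.builders Context R V of Lmodule_hasInner R V.

HB.instance Definition _ := Lmodule_isNormed.Build R[i] V
  (inn_normD innL innC inn_ge0 inn_eq0) (inn_normZ innL innC inn_ge0)
  (inn_norm_eq0 inn_eq0).

Let inn_normE x : inn x x = `|x| ^+ 2.
Proof. by rewrite [in RHS]/Num.norm /= /inn_norm sqrtCK. Qed.

HB.instance Definition _ := hasInner.Build R V innL innC inn_normE.

HB.end.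

Section PreHilbertTheory.
Variables (R : realType) (V : preHilbertType R).
Implicit Types (x y z : V) (a : R[i]).

Lemma innerDl x y z : inner (x + y) z = inner x z + inner y z.
Proof. exact: (@innDl R V inner (@inner_linear R V)). Qed.

Lemma innerDr x y z : inner z (x + y) = inner z x + inner z y.
Proof. exact: (@innDr R V inner (@inner_linear R V) (@inner_conj R V)). Qed.

Lemma innerZl a x z : inner (a *: x) z = a * inner x z.
Proof. exact: (@innZl R V inner (@inner_linear R V)). Qed.

Lemma innerZr a x z : inner z (a *: x) = a^* * inner z x.
Proof. exact: (@innZr R V inner (@inner_linear R V) (@inner_conj R V)). Qed.

Lemma innerNl x z : inner (- x) z = - inner x z.
Proof. exact: (@innNl R V inner (@inner_linear R V)). Qed.

Lemma innerNr x z : inner z (- x) = - inner z x.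
Proof. exact: (@innNr R V inner (@inner_linear R V) (@inner_conj R V)). Qed.

Lemma inner0l z : inner 0 z = 0.
Proof. exact: (@inn0l R V inner (@inner_linear R V)). Qed.

Lemma inner0r z : inner z 0 = 0.
Proof. by rewrite inner_conj inner0l rmorph0. Qed.

Lemma inner_ge0 x : 0 <= inner x x.
Proof. by rewrite inner_norm exprn_ge0. Qed.

Lemma inner_eq0 x : inner x x = 0 -> x = 0.
Proof. by rewrite inner_norm => /eqP; rewrite sqrf_eq0 normr_eq0 => /eqP. Qed.

Lemma inner_CS x y : `|inner x y| <= `|x| * `|y|.
Proof.
rewrite -(@ler_pXn2r _ 2%N) ?nnegrE ?mulr_ge0 // exprMn -!inner_norm.
exact: (@inn_CS R V inner (@inner_linear R V) (@inner_conj R V) inner_ge0 inner_eq0).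
Qed.

Lemma inner_inj x y : (forall z, inner x z = inner y z) -> x = y.
Proof.
move=> xy; apply/eqP; rewrite -subr_eq0; apply/eqP/inner_eq0.
by rewrite innerDl innerNl xy subrr.
Qed.

Definition rnorm x : R := complex.Re `|x|.

Lemma rnormE x : `|x| = (rnorm x)%:C%C.
Proof. by rewrite /rnorm RRe_real ?normr_real. Qed.

Lemma rnorm_ge0 x : 0 <= rnorm x.
Proof. by rewrite -(@lecR R 0) -rnormE normr_ge0. Qed.

Lemma rnormD x y : rnorm (x + y) <= rnorm x + rnorm y.
Proof. by rewrite -(@lecR R) rmorphD /= -!rnormE ler_normD. Qed.

Lemma rnormN x : rnorm (- x) = rnorm x.
Proof. by rewrite /rnorm normrN. Qed.

Lemma rnormBC x y : rnorm (x - y) = rnorm (y - x).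
Proof. by rewrite -rnormN opprB. Qed.

Lemma rnormZ (a : R) x : rnorm (a%:C%C *: x) = `|a| * rnorm x.
Proof.
apply: (@complexI R); rewrite rmorphM /= -!rnormE normrZ.
by congr (_ * _); rewrite normc_def /= expr0n addr0 sqrtr_sqr.
Qed.

Lemma rnorm0 : rnorm 0 = 0.
Proof. by rewrite /rnorm normr0. Qed.

Lemma rnorm_eq0 x : rnorm x = 0 -> x = 0.
Proof. by move=> x0; apply/eqP; rewrite -normr_eq0 rnormE x0. Qed.

Definition rinner x y : R := complex.Re (inner x y).

Lemma rinnerDl x y z : rinner (x + y) z = rinner x z + rinner y z.
Proof. by rewrite /rinner innerDl raddfD. Qed.
Lemma rinnerDr x y z : rinner z (x + y) = rinner z x + rinner z y.
Proof. by rewrite /rinner innerDr raddfD. Qed.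
Lemma rinnerNl x z : rinner (- x) z = - rinner x z.
Proof. by rewrite /rinner innerNl raddfN. Qed.
Lemma rinnerNr x z : rinner z (- x) = - rinner z x.
Proof. by rewrite /rinner innerNr raddfN. Qed.
Lemma rinnerC x y : rinner x y = rinner y x.
Proof. by rewrite /rinner inner_conj; case: (inner y x). Qed.
Lemma rinnerZl (a : R) x y : rinner (a%:C%C *: x) y = a * rinner x y.
Proof.
by rewrite /rinner innerZl; case: (inner x y) => u v /=; rewrite mul0r subr0.
Qed.
Lemma rinnerZr (a : R) x y : rinner y (a%:C%C *: x) = a * rinner y x.
Proof. by rewrite rinnerC rinnerZl rinnerC. Qed.
Lemma rinnerxx x : rinner x x = rnorm x ^+ 2.
Proof.
by rewrite /rinner inner_norm rnormE -rmorphXn.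
Qed.

Lemma rinner_CS x y : `|rinner x y| <= rnorm x * rnorm y.
Proof.
rewrite -(@lecR R) rmorphM /= -!rnormE; apply: le_trans (inner_CS x y).
exact: normc_ge_Re.
Qed.

Lemma ball_rnorm x (e : R[i]) y : 0 < e ->
  ball x e y <-> rnorm (x - y) < complex.Re e.
Proof.
move=> e0; rewrite -ball_normE /ball_ /= rnormE -[e]RRe_real ?gtr0_real //.
by rewrite ltcR.
Qed.

Lemma cvg_rnorm (F : set_system V) (FF : Filter F) x :
  F --> x <-> forall e : R, 0 < e -> F [set y | rnorm (x - y) < e].
Proof.
split=> [Fx e e0|Fx].
  have e0' : 0 < e%:C%C by rewrite -(@ltcR R 0) in e0.
  have := Fx _ (nbhsx_ballx x _ e0'); apply: filterS => y /=.
  by move/(ball_rnorm _ _ e0').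
apply/cvg_ballP => e e0; have e0' : 0 < complex.Re e.
  by rewrite -(@ltcR R) RRe_real // gtr0_real.
by apply: filterS (Fx _ e0') => y /= h; apply/ball_rnorm.
Qed.

Lemma cauchy_rnorm (F : set_system V) (FF : ProperFilter F) :
  cauchy F <-> forall e : R, 0 < e -> exists x, F [set y | rnorm (x - y) < e].
Proof.
rewrite cauchyP; split=> [Fx e e0|Fx e e0].
  have e0' : 0 < e%:C%C by rewrite -(@ltcR R 0) in e0.
  have [x Fex] := Fx _ e0'; exists x; apply: filterS Fex => y /=.
  by move/(ball_rnorm _ _ e0').
have e0' : 0 < complex.Re e by rewrite -(@ltcR R) RRe_real // gtr0_real.
have [x Fex] := Fx _ e0'; exists x.
by apply: filterS Fex => y /= h; apply/ball_rnorm.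
Qed.

End PreHilbertTheory.

Lemma rnorm_cauchy_complete (R : realType) (V : preHilbertType R) :
  (forall F : set_system V, ProperFilter F ->
     (forall e : R, 0 < e -> exists x, F [set y | rnorm (x - y) < e]) ->
     exists l : V, forall e : R, 0 < e -> F [set y | rnorm (l - y) < e]) ->
  forall F : set_system V, ProperFilter F -> cauchy F -> cvg F.
Proof.
move=> h F PF /cauchy_rnorm cF; have [l Fl] := h F PF cF.
by apply/cvg_ex; exists l; apply/cvg_rnorm.
Qed.

Lemma rnorm_complete (R : realType) (V : hilbertType R) (F : set_system V) :
  ProperFilter F ->
  (forall e : R, 0 < e -> exists x, F [set y | rnorm (x - y) < e]) ->
  exists l : V, forall e : R, 0 < e -> F [set y | rnorm (l - y) < e].
Proof.
move=> PF /cauchy_rnorm/cauchy_cvg/cvg_ex[l Fl].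
by exists l; apply/cvg_rnorm.
Qed.

Record bop (R : realType) (V W : hilbertType R) := Bop {
  bop_fun :> {linear V -> W};
  bop_continuous : continuous bop_fun }.

Notation "''B' ( V , W )" := (bop V W)
  (at level 8, format "''B' ( V ,  W )") : type_scope.
Notation "''B' ( V )" := (bop V V)
  (at level 8, format "''B' ( V )") : type_scope.

Section BoundedOperators.
Variables (R : realType) (V W : hilbertType R).

Lemma bop_bounded (T : 'B(V, W)) :
  exists2 M : R, 0 <= M & forall x, rnorm (T x) <= M * rnorm x.
Proof.
have /linear_bounded_continuous/linear_boundedP/pinfty_ex_gt0[r r0 Tr] :=
  @bop_continuous _ _ _ T.
exists (complex.Re r) => [|x].
  by rewrite -(@lecR R) RRe_real ?gtr0_real // ltW.
by rewrite -(@lecR R) rmorphM /= (@RRe_real _ r) ?gtr0_real // -!rnormE.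
Qed.

Lemma bounded_continuous (f : V -> W) (M : R) :
  (forall x y, f (x - y) = f x - f y) ->
  (forall x, rnorm (f x) <= M * rnorm x) -> continuous f.
Proof.
move=> fB fM x; apply/cvg_rnorm => e e0.
have M0 : 0 < `|M| + 1 by rewrite ltr_pwDr.
have /cvg_rnorm/(_ _ (divr_gt0 e0 M0)) : nbhs x --> x by [].
apply: filterS => y /=; rewrite ltr_pdivlMr // mulrC -fB.
apply: le_lt_trans; apply: (le_trans (fM _)).
by rewrite ler_wpM2r ?rnorm_ge0 // (le_trans (ler_norm _)) // lerDl.
Qed.

Lemma bop_of (f : V -> W) (M : R) :
  linear f -> (forall x, rnorm (f x) <= M * rnorm x) ->
  {T : 'B(V, W) | T =1 f}.
Proof.
move=> fL fM.
pose fl : {linear V -> W} := HB.pack f (GRing.isLinear.Build R[i] V W _ f fL).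
have fB x y : f (x - y) = f x - f y by exact: (raddfB fl).
by exists (@Bop _ _ _ fl (bounded_continuous fB fM)).
Qed.

End BoundedOperators.

Section Riesz.
Variables (R : realType) (V : hilbertType R).
Variables (f : V -> R[i]) (M : R).
Implicit Types x y : V.
Hypothesis fL : forall a x y, f (a *: x + y) = a * f x + f y.
Hypothesis fM : forall x, `|f x| <= (M * rnorm x)%:C%C.

Let g x : R := complex.Re (f x).
Let gL (t : R) x y : g (t%:C%C *: x + y) = t * g x + g y.
Proof.
by rewrite /g fL raddfD /=; case: (f x) => u v /=; rewrite mul0r subr0.
Qed.
Let J x : R := rnorm x ^+ 2 - 2 * g x.

Let gM x : `|g x| <= M * rnorm x.
Proof. by rewrite -(@lecR R); apply: le_trans (fM x); exact: normc_ge_Re. Qed.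

Let J_lb x : - M ^+ 2 <= J x.
Proof.
rewrite /J; have := gM x; rewrite ler_norml => /andP[_ gx].
have : 0 <= (rnorm x - M) ^+ 2 by exact: sqr_ge0.
nra.
Qed.

Let rn2 (t : R) x y : rnorm (x + t%:C%C *: y) ^+ 2 =
  rnorm x ^+ 2 + 2 * t * rinner x y + t ^+ 2 * rnorm y ^+ 2.
Proof.
rewrite -!rinnerxx !(rinnerDl, rinnerDr, rinnerZl, rinnerZr) (rinnerC y x).
by ring.
Qed.

Let J_shift (t : R) x y :
  J (x + t%:C%C *: y) = J x + 2 * t * (rinner x y - g y) + t ^+ 2 * rnorm y ^+ 2.
Proof. by rewrite /J rn2 addrC [in g _]addrC gL; ring. Qed.

Let j := inf (range J).

Let has_infJ : has_inf (range J).
Proof.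
split; first by exists (J 0); exists 0.
by exists (- M ^+ 2) => _ [x _ <-]; exact: J_lb.
Qed.

Let j_le x : j <= J x.
Proof. by apply: ge_inf; [exact: (proj2 has_infJ)|exists x]. Qed.

Let J_dist x y : rnorm (x - y) ^+ 2 <= 2 * (J x + J y - 2 * j).
Proof.
have h := j_le (y + (2^-1)%:C%C *: (x - y)).
have := J_shift 1 y (x - y); rewrite scale1r addrC subrK.
move: h; rewrite J_shift.
set A := rinner _ _ - _; set B := rnorm (x - y) ^+ 2; rewrite !expr2 => h1 h2.
lra.
Qed.

Let ex_seq : exists u : nat -> V, forall n, J (u n) < j + n.+1%:R^-1.
Proof.
have /choice[u uP] : forall n, exists x, J x < j + n.+1%:R^-1.
  move=> n; have n0 : 0 < n.+1%:R^-1 :> R by rewrite invr_gt0.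
  by have [_ [x _ <-] Jx] := inf_adherent n0 has_infJ; exists x.
by exists u.
Qed.

Lemma riesz_real : exists x, forall y, rinner x y = g y.
Proof.
have [u uP] := ex_seq.
have small (e : R) : 0 < e -> exists N, forall n, (N <= n)%N -> n.+1%:R^-1 < e.
  move=> e0; exists (Num.truncn e^-1) => n Nn.
  rewrite invf_plt ?posrE // (lt_le_trans (truncnS_gt _)) //.
  by rewrite ler_nat.
have [x xP] : exists l, forall e : R, 0 < e ->
    (u @ \oo) [set y | rnorm (l - y) < e].
  apply: rnorm_complete => e e0.
  have e20 : 0 < e ^+ 2 / 4 by rewrite divr_gt0 ?exprn_gt0.
  have [N NP] := small _ e20.
  exists (u N); exists N => // n /= Nn.
  rewrite -(@ltr_pXn2r _ 2%N) ?nnegrE ?rnorm_ge0 ?ltW //.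
  apply: le_lt_trans (J_dist _ _) _.
  have := uP n; have := uP N; have := NP _ Nn; have := NP _ (leqnn N).
  move: (J _) (J _) (n.+1%:R^-1) (N.+1%:R^-1) (e ^+ 2) => a b c d e2; lra.
exists x => y; apply/eqP; rewrite -subr_eq0; set c := rinner x y - g y.
have key (t : R) : 0 <= 2 * t * c + t ^+ 2 * rnorm y ^+ 2.
  apply/ler_addgt0Pr => e e0.
  pose K : R := 1 + 2 * `|t| * rnorm y.
  have K0 : 0 < K by rewrite ltr_pwDl // !mulr_ge0 // rnorm_ge0.
  have e1 : 0 < e / K by rewrite divr_gt0.
  have [N NP] := small _ e1.
  have [N' _ N'P] := xP _ e1.
  pose n := maxn N N'.
  have h1 := NP n (leq_maxl _ _).
  have h2 : rnorm (x - u n) < e / K := N'P n (leq_maxr _ _).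
  have h3 := uP n.
  have h4 := j_le (u n + t%:C%C *: y).
  rewrite J_shift in h4.
  have h5 : - (2 * t * (rinner (u n) y - rinner x y)) >= - (2 * `|t| * (e / K * rnorm y)).
    rewrite lerN2 -mulrA -[leRHS]mulrA ler_pM2l //.
    apply: (le_trans (ler_norm _)); rewrite normrM ler_wpM2l //.
    rewrite -rinnerNl -rinnerDl (le_trans (rinner_CS _ _)) //.
    by rewrite ler_wpM2r ?rnorm_ge0 // rnormBC ltW.
  have h6 : e = e / K + 2 * `|t| * (e / K * rnorm y).
    rewrite -[LHS](divfK (lt0r_neq0 K0)) {2}/K; ring.
  rewrite /c; move: h1 h3 h4 h5 h6.
  set A := 2 * `|t| * _; move: (n.+1%:R^-1) (e / K) A => q ek A.
  lra.
have := key (- c / (rnorm y ^+ 2 + 1)).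
set B := rnorm y ^+ 2; have B0 : 0 <= B by exact: sqr_ge0.
have B1 : 0 < B + 1 by rewrite ltr_pwDr.
have -> : 2 * (- c / (B + 1)) * c + (- c / (B + 1)) ^+ 2 * B =
   - (c ^+ 2 * ((B + 2) / (B + 1) ^+ 2)).
  by field; rewrite lt0r_neq0.
rewrite oppr_ge0 pmulr_lle0 ?divr_gt0 ?exprn_gt0 ?ltr_wpDl // => c2.
by rewrite -sqrf_eq0 eq_le c2 sqr_ge0.
Qed.

Lemma riesz : exists x, forall y, f y = inner y x.
Proof.
have [x xP] := riesz_real; exists x => y.
have Re1 z : complex.Re (f z) = complex.Re (inner z x).
  by rewrite -[LHS]/(g z) -xP rinnerC.
apply/eqP; rewrite eq_complex Re1 eqxx /=; apply/eqP.
have f0 : f 0 = 0 by have := fL (-1) 0 0; rewrite scaler0 addr0 mulN1r addNr.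
have := Re1 ('i%C *: y); rewrite innerZl -[_ *: y]addr0 fL f0 addr0.
by case: (f y) (inner y x) => a b [c d] /=; lra.
Qed.

End Riesz.

Section Adjoint.
Variables (R : realType) (V W : hilbertType R).

Lemma ex_adj (T : 'B(V, W)) :
  exists S : 'B(W, V), forall x y, inner (T x) y = inner x (S y).
Proof.
have [M M0 TM] := bop_bounded T.
have /choice[S SP] : forall y, exists z, forall x, inner (T x) y = inner x z.
  move=> y; apply: (@riesz _ _ _ (M * rnorm y)) => [a x x'|x].
    by rewrite linearP innerDl innerZl.
  apply: (le_trans (inner_CS _ _)); rewrite !rnormE -rmorphM lecR.
  by rewrite mulrAC ler_wpM2r ?rnorm_ge0.
have SL : linear S.
  move=> a x y; apply: inner_inj => z.
  rewrite inner_conj -SP [RHS]inner_conj !innerDr !innerZr -!SP.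
  by rewrite !SP.
have SM x : rnorm (S x) <= M * rnorm x.
  have [/rnorm_eq0->|Sx] := eqVneq (rnorm (S x)) 0.
    by rewrite rnorm0 mulr_ge0 ?rnorm_ge0.
  have Sx0 : 0 < rnorm (S x) by rewrite lt_def Sx rnorm_ge0.
  rewrite -(ler_pM2l Sx0) -expr2 -rinnerxx /rinner -SP.
  apply: le_trans (ler_norm _) _; apply: le_trans (rinner_CS _ _) _.
  by rewrite mulrA [_ * M]mulrC ler_wpM2r ?rnorm_ge0.
have [S' S'E] := bop_of SL SM.
by exists S' => x y; rewrite S'E SP.
Qed.

Definition adj (T : 'B(V, W)) : 'B(W, V) := projT1 (cid (ex_adj T)).

Lemma adjP (T : 'B(V, W)) x y : inner (T x) y = inner x (adj T y).
Proof. exact: (projT2 (cid (ex_adj T))). Qed.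

End Adjoint.

Lemma closure_rnorm (R : realType) (V : preHilbertType R) (A : set V) x :
  closure A x <-> forall e : R, 0 < e -> exists2 a, A a & rnorm (x - a) < e.
Proof.
split=> [Ax e e0|Ax B].
  have /cvg_rnorm/(_ _ e0) : nbhs x --> x by [].
  by move=> /Ax[a [Aa xa]]; exists a.
move=> /nbhs_ballP[e /= e0 xeB].
have e0' : 0 < complex.Re e by rewrite -(@ltcR R) RRe_real // gtr0_real.
have [a Aa xa] := Ax _ e0'; exists a; split=> //.
by apply: xeB; apply/ball_rnorm.
Qed.

Lemma rnormZC (R : realType) (V : preHilbertType R) (a : R[i]) (x : V) :
  rnorm (a *: x) = complex.Re `|a| * rnorm x.
Proof.
by rewrite [LHS]/rnorm normrZ rnormE -[`|a|]RRe_real ?normr_real // -rmorphM.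
Qed.

Record closedSubspace (R : realType) (V : hilbertType R) := ClosedSubspace {
  csub_set :> set V;
  csub_submod : submod_closed (mem csub_set);
  csub_closed : closed csub_set }.

Section ClosedSubspace.
Variables (R : realType) (V : hilbertType R) (W : closedSubspace V).

Definition csub_pred : {pred V} := mem (csub_set W).

HB.instance Definition _ := GRing.isSubmodClosed.Build R[i] V csub_pred
  (csub_submod W).

Record csub_type := CSub { csub_val :> V; csub_valP : csub_val \in csub_pred }.

HB.instance Definition _ := [isSub for csub_val].
HB.instance Definition _ := [Choice of csub_type by <:].
HB.instance Definition _ := [SubChoice_isSubLmodule of csub_type by <:].

Definition csub_inner (x y : csub_type) : R[i] := inner (val x) (val y).

Let csub_innerL (a : R[i]) x y z :
  csub_inner (a *: x + y) z = a * csub_inner x z + csub_inner y z.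
Proof. by rewrite /csub_inner linearP inner_linear. Qed.

Let csub_innerC x y : csub_inner y x = (csub_inner x y)^*.
Proof. exact: inner_conj. Qed.

Let csub_inner_ge0 x : 0 <= csub_inner x x.
Proof. exact: inner_ge0. Qed.

Let csub_inner_eq0 x : csub_inner x x = 0 -> x = 0.
Proof. by move=> /inner_eq0 x0; apply/val_inj; rewrite x0 linear0. Qed.

HB.instance Definition _ := Lmodule_hasInner.Build R csub_type
  csub_innerL csub_innerC csub_inner_ge0 csub_inner_eq0.

Lemma csub_rnorm (x : csub_type) : rnorm x = rnorm (val x).
Proof.
by apply/eqP; rewrite -(@eqrXn2 _ 2%N) ?rnorm_ge0 // -!rinnerxx.
Qed.

Let csub_complete (F : set_system csub_type) :
  ProperFilter F -> cauchy F -> cvg F.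
Proof.
apply: rnorm_cauchy_complete => {}F PF cF.
have [l Fl] : exists l : V, forall e : R, 0 < e ->
    (val @ F) [set y | rnorm (l - y) < e].
  apply: rnorm_complete => e e0; have [x Fx] := cF _ e0.
  exists (val x); rewrite /=; near=> y => /=.
  have : rnorm (x - y) < e by near: y.
  by rewrite csub_rnorm linearB.
have Wl : l \in csub_pred.
  apply/mem_set/(csub_closed (c := W))/closure_rnorm => e e0.
  have [a ae] : exists a : csub_type, rnorm (l - val a) < e.
    exact: (@filter_ex _ F _ _ (Fl _ e0)).
  by exists (val a) => //; apply/set_mem; exact: (valP a).
exists (CSub Wl) => e e0; near=> y => /=.
by rewrite csub_rnorm linearB /=; near: y; exact: Fl.
Unshelve. all: by end_near. Qed.

HB.instance Definition _ := Uniform_isComplete.Build csub_type csub_complete.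

End ClosedSubspace.

Section DirectSum.
Variables (R : realType) (V W : hilbertType R).

(* The product type already carries the sup norm, hence a new name for the
   Hilbert direct sum. *)
Definition hsum : Type := (V * W)%type.

HB.instance Definition _ := GRing.Lmodule.copy hsum (V * W)%type.

Definition hsum_inner (x y : hsum) : R[i] := inner x.1 y.1 + inner x.2 y.2.

Let hsum_innerL (a : R[i]) x y z :
  hsum_inner (a *: x + y) z = a * hsum_inner x z + hsum_inner y z.
Proof. by rewrite /hsum_inner /= !inner_linear mulrDr addrACA. Qed.

Let hsum_innerC x y : hsum_inner y x = (hsum_inner x y)^*.
Proof. by rewrite /hsum_inner rmorphD /= -!inner_conj. Qed.

Let hsum_inner_ge0 x : 0 <= hsum_inner x x.
Proof. by rewrite addr_ge0 ?inner_ge0. Qed.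

Let hsum_inner_eq0 x : hsum_inner x x = 0 -> x = 0.
Proof.
move=> /eqP; rewrite paddr_eq0 ?inner_ge0 //; case: x => x1 x2 /=.
by case/andP=> /eqP/inner_eq0-> /eqP/inner_eq0->.
Qed.

HB.instance Definition _ := Lmodule_hasInner.Build R hsum
  hsum_innerL hsum_innerC hsum_inner_ge0 hsum_inner_eq0.

Lemma hsum_rnorm (x : hsum) : rnorm x ^+ 2 = rnorm x.1 ^+ 2 + rnorm x.2 ^+ 2.
Proof. by rewrite -!rinnerxx /rinner -raddfD. Qed.

Let hsum_rnorm1 (x : hsum) : rnorm x.1 <= rnorm x.
Proof.
rewrite -(@ler_pXn2r _ 2%N) ?nnegrE ?rnorm_ge0 // hsum_rnorm lerDl.
exact: sqr_ge0.
Qed.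

Let hsum_rnorm2 (x : hsum) : rnorm x.2 <= rnorm x.
Proof.
rewrite -(@ler_pXn2r _ 2%N) ?nnegrE ?rnorm_ge0 // hsum_rnorm lerDr.
exact: sqr_ge0.
Qed.

Let hsum_rnormD (x : hsum) : rnorm x <= rnorm x.1 + rnorm x.2.
Proof.
rewrite -(@ler_pXn2r _ 2%N) ?nnegrE ?addr_ge0 ?rnorm_ge0 // hsum_rnorm.
by have := rnorm_ge0 x.1; have := rnorm_ge0 x.2; nra.
Qed.

Let hsum_complete (F : set_system hsum) : ProperFilter F -> cauchy F -> cvg F.
Proof.
apply: rnorm_cauchy_complete => {}F PF cF.
have [l1 Fl1] : exists l : V, forall e : R, 0 < e ->
    ((fun x : hsum => x.1) @ F) [set y | rnorm (l - y) < e].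
  apply: rnorm_complete => e e0; have [x Fx] := cF _ e0.
  exists x.1; rewrite /=; near=> y => /=.
  by apply: (le_lt_trans (hsum_rnorm1 (x - y))); near: y.
have [l2 Fl2] : exists l : W, forall e : R, 0 < e ->
    ((fun x : hsum => x.2) @ F) [set y | rnorm (l - y) < e].
  apply: rnorm_complete => e e0; have [x Fx] := cF _ e0.
  exists x.2; rewrite /=; near=> y => /=.
  by apply: (le_lt_trans (hsum_rnorm2 (x - y))); near: y.
exists (l1, l2) => e e0; near=> y => /=.
apply: (le_lt_trans (hsum_rnormD _)); rewrite /= [e]splitr ltrD //.
  by near: y; apply: Fl1; rewrite divr_gt0.
by near: y; apply: Fl2; rewrite divr_gt0.
Unshelve. all: by end_near. Qed.

HB.instance Definition _ := Uniform_isComplete.Build hsum hsum_complete.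

End DirectSum.

Section SquareSummable.
Variables (R : realType) (V : hilbertType R).

Definition square_summable (a : nat -> V) : Prop :=
  cvgn (series (fun n => rnorm (a n) ^+ 2)).

Definition ell2_pred : {pred (nat -> V)} := fun a => `[< square_summable a >].

Lemma square_summableP (a : nat -> V) :
  square_summable a <->
  exists M : R, forall n, \sum_(0 <= k < n) rnorm (a k) ^+ 2 <= M.
Proof.
split=> [ca|[M aM]].
  exists (limn (series (fun n => rnorm (a n) ^+ 2))) => n.
  apply: (@nondecreasing_cvgn_le _ (series (fun n => rnorm (a n) ^+ 2))) => //.
  by apply: nondecreasing_series => k _ _; exact: sqr_ge0.
apply: nondecreasing_is_cvgn.
  by apply: nondecreasing_series => k _ _; exact: sqr_ge0.
by exists M => _ [n _ <-]; exact: aM.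
Qed.

Lemma square_summable_submod : submod_closed ell2_pred.
Proof.
split.
  apply/asboolP/square_summableP; exists 0 => n.
  by rewrite big1 // => k _; rewrite rnorm0 expr0n.
move=> c u v /asboolP/square_summableP[M uM] /asboolP/square_summableP[N vN].
apply/asboolP/square_summableP; pose d := complex.Re `|c|.
exists (2 * (d ^+ 2 * M) + 2 * N) => n.
apply: (@le_trans _ _ (\sum_(0 <= k < n)
    (2 * (d ^+ 2 * rnorm (u k) ^+ 2) + 2 * rnorm (v k) ^+ 2))).
  apply: ler_sum => k _; have := rnormD (c *: u k) (v k).
  rewrite rnormZC -/d -exprMn; have := rnorm_ge0 (c *: u k + v k).
  move: (rnorm _) (d * _) (rnorm _) => r q p p0 pqr.
  have : p ^+ 2 <= (q + r) ^+ 2.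
    by rewrite ler_pXn2r ?nnegrE ?(le_trans p0 pqr).
  have := sqr_ge0 (q - r); rewrite !expr2; nra.
rewrite big_split /= -!mulr_sumr; apply: lerD; last by rewrite ler_pM2l.
by rewrite ler_pM2l // ler_wpM2l ?sqr_ge0.
Qed.

HB.instance Definition _ := GRing.isSubmodClosed.Build R[i] (nat -> V) ell2_pred
  square_summable_submod.

Record ell2 := Ell2 { ell2_fun :> nat -> V; ell2P : ell2_fun \in ell2_pred }.

HB.instance Definition _ := [isSub for ell2_fun].
HB.instance Definition _ := [Choice of ell2 by <:].
HB.instance Definition _ := [SubChoice_isSubLmodule of ell2 by <:].

End SquareSummable.

Section ComplexLimits.
Variable R : realType.
Implicit Types (z : nat -> R[i]).

Lemma normc_le_ReIm (w : R[i]) :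
  `|w| <= (`|complex.Re w| + `|complex.Im w|)%:C%C.
Proof.
case: w => a b /=; rewrite normc_def lecR /=.
rewrite -(@ler_pXn2r _ 2%N) ?nnegrE ?addr_ge0 ?sqrtr_ge0 //.
rewrite sqr_sqrtr ?addr_ge0 ?sqr_ge0 // sqrrD !real_normK ?num_real //.
by rewrite addrAC lerDl mulrn_wge0 // mulr_ge0.
Qed.

Lemma normc_ge_Im (w : R[i]) : `|complex.Im w|%:C%C <= `|w|.
Proof.
have := normc_ge_Re ('i%C * w); rewrite normrM.
have -> : `|'i%C : R[i]| = 1 by rewrite normc_def /= expr0n expr1n add0r sqrtr1.
by rewrite mul1r; case: w => u v /=; rewrite mul0r mul1r sub0r normrN.
Qed.

Lemma cvg_complex z (p q : R) :
  (fun n => complex.Re (z n)) @ \oo --> p ->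
  (fun n => complex.Im (z n)) @ \oo --> q ->
  (z : nat -> R[i]^o) @ \oo --> (Complex p q : R[i]^o).
Proof.
move=> zp zq; apply/cvgrPdist_lt => e e0.
have e0' : 0 < complex.Re e / 2.
  by rewrite divr_gt0 // -(@ltcR R) RRe_real // gtr0_real.
have /cvgrPdist_lt/(_ _ e0') P := zp.
have /cvgrPdist_lt/(_ _ e0') Q := zq.
near=> n; rewrite -[e]RRe_real ?gtr0_real //.
apply: (le_lt_trans (normc_le_ReIm _)); rewrite ltcR [ltRHS]splitr.
rewrite !raddfB /= ltrD //; near: n; [exact: P|exact: Q].
Unshelve. all: by end_near. Qed.

End ComplexLimits.

Section Ell2.
Variables (R : realType) (V : hilbertType R).
Implicit Types a b c : ell2 V.

Lemma ell2_summable a : square_summable a.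
Proof. exact/asboolP/(ell2P a). Qed.

(* R[i] carries its canonical topology through the alias R[i]^o. *)
Definition ell2_inner a b : R[i] :=
  limn (series (fun n => inner (a n) (b n)) : nat -> R[i]^o).

Let abs_cvg (f : nat -> R) a b :
  (forall n, `|f n| <= rnorm (a n) * rnorm (b n)) -> cvgn (series f).
Proof.
move=> fab; apply: normed_cvg.
have h (n : nat) : `|f n| <= rnorm (a n) ^+ 2 + rnorm (b n) ^+ 2.
  apply: (le_trans (fab n)); move: (rnorm_ge0 (a n)) (rnorm_ge0 (b n)).
  by move: (rnorm _) (rnorm _) => p q p0 q0; nra.
apply: (series_le_cvg _ _ h) => [n|n|] //; first by rewrite addr_ge0 ?sqr_ge0.
rewrite -[X in cvgn (series X)]/((fun n => rnorm (a n) ^+ 2) +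
  (fun n => rnorm (b n) ^+ 2)) seriesD.
by apply: is_cvgD; exact: ell2_summable.
Qed.

Let Re_series (z : nat -> R[i]) :
  (fun n => complex.Re (series z n)) = series (fun n => complex.Re (z n)).
Proof. by apply/funext => n; rewrite /series /= raddf_sum. Qed.

Let Im_series (z : nat -> R[i]) :
  (fun n => complex.Im (series z n)) = series (fun n => complex.Im (z n)).
Proof. by apply/funext => n; rewrite /series /= raddf_sum. Qed.

Lemma ell2_inner_cvg a b :
  (series (fun n => inner (a n) (b n)) : nat -> R[i]^o) @ \oo -->
  (ell2_inner a b : R[i]^o).
Proof.
apply/cvg_ex; exists (Complex (limn (series (fun n => complex.Re (inner (a n) (b n)))))
  (limn (series (fun n => complex.Im (inner (a n) (b n)))))).
apply: cvg_complex.
  rewrite Re_series; apply: (abs_cvg (a := a) (b := b)) => n.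
  exact: rinner_CS.
rewrite Im_series; apply: (abs_cvg (a := a) (b := b)) => n.
rewrite -(@lecR R) rmorphM /= -!rnormE; apply: le_trans (inner_CS _ _).
exact: normc_ge_Im.
Qed.

Let ell2_innerE a b (l : R[i]) :
  (series (fun n => inner (a n) (b n)) : nat -> R[i]^o) @ \oo --> (l : R[i]^o) ->
  ell2_inner a b = l.
Proof.
move=> abl; rewrite /ell2_inner.
by move/(@cvg_lim R[i]^o (@norm_hausdorff _ R[i]^o)): abl.
Qed.

Let ell2_innerL (d : R[i]) a b c :
  ell2_inner (d *: a + b) c = d * ell2_inner a c + ell2_inner b c.
Proof.
apply: ell2_innerE.
rewrite (_ : series _ = (fun n => (d : R[i]^o) *: (series (fun n => inner (a n) (c n)) n : R[i]^o) +
  (series (fun n => inner (b n) (c n)) n : R[i]^o))).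
  by apply: cvgD; [apply: cvgZr|]; exact: ell2_inner_cvg.
apply/funext => n; rewrite /series /= scaler_sumr -big_split /=.
by apply: eq_bigr => k _; rewrite inner_linear.
Qed.

Let ell2_innerC a b : ell2_inner b a = (ell2_inner a b)^*.
Proof.
apply: ell2_innerE; apply/cvgrPdist_lt => e e0.
have /cvgrPdist_lt/(_ _ e0) := @ell2_inner_cvg a b.
apply: filterS => n; rewrite -norm_conjC rmorphB /=.
suff -> : (series (fun n => inner (a n) (b n)) n)^* =
  series (fun n => inner (b n) (a n)) n by [].
rewrite /series /= rmorph_sum; apply: eq_bigr => k _.
by rewrite [RHS]inner_conj.
Qed.

Lemma ell2_inner_norm a :
  ell2_inner a a = (limn (series (fun n => rnorm (a n) ^+ 2)))%:C%C.
Proof.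
apply: ell2_innerE; apply: cvg_complex.
  rewrite Re_series (_ : (fun n => _) = (fun n => rnorm (a n) ^+ 2)).
    exact: ell2_summable.
  by apply/funext => n; rewrite -rinnerxx.
rewrite Im_series (_ : (fun n => _) = (fun n => 0)).
  rewrite (_ : series _ = (fun n => 0)); first exact: cvg_cst.
  by apply/funext => n; rewrite /series /= big1.
by apply/funext => n; rewrite inner_norm rnormE -rmorphXn.
Qed.

Let psum_le a n : \sum_(0 <= k < n) rnorm (a k) ^+ 2 <=
  limn (series (fun n => rnorm (a n) ^+ 2)).
Proof.
apply: (@nondecreasing_cvgn_le _ (series (fun n => rnorm (a n) ^+ 2))).
  by apply: nondecreasing_series => k _ _; exact: sqr_ge0.
exact: ell2_summable.
Qed.

Let ell2_inner_ge0 a : 0 <= ell2_inner a a.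
Proof.
rewrite ell2_inner_norm (@lecR R 0); apply: (le_trans _ (psum_le a 0)).
by rewrite big_geq.
Qed.

Let ell2_inner_eq0 a : ell2_inner a a = 0 -> a = 0.
Proof.
rewrite ell2_inner_norm => /complexI a0; apply/val_inj/funext => n /=.
apply/rnorm_eq0/eqP; rewrite -sqrf_eq0 eq_le sqr_ge0 andbT -a0.
apply: le_trans (psum_le a n.+1); rewrite big_nat_recr //= lerDr.
by apply: sumr_ge0 => k _; exact: sqr_ge0.
Qed.

HB.instance Definition _ := Lmodule_hasInner.Build R (ell2 V)
  ell2_innerL ell2_innerC ell2_inner_ge0 ell2_inner_eq0.

Lemma ell2_rnorm a : rnorm a ^+ 2 = limn (series (fun n => rnorm (a n) ^+ 2)).
Proof. by rewrite -rinnerxx /rinner [inner a a]ell2_inner_norm. Qed.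

Lemma ell2_psum_le a n : \sum_(0 <= k < n) rnorm (a k) ^+ 2 <= rnorm a ^+ 2.
Proof. by rewrite ell2_rnorm psum_le. Qed.

Lemma ell2_rnorm_le a (M : R) : 0 <= M ->
  (forall n, \sum_(0 <= k < n) rnorm (a k) ^+ 2 <= M ^+ 2) -> rnorm a <= M.
Proof.
move=> M0 aM; rewrite -(@ler_pXn2r _ 2%N) ?nnegrE ?rnorm_ge0 // ell2_rnorm.
by apply: limr_le; [exact: ell2_summable|apply: nearW; exact: aM].
Qed.

Lemma ell2_coord_le a n : rnorm (a n) <= rnorm a.
Proof.
rewrite -(@ler_pXn2r _ 2%N) ?nnegrE ?rnorm_ge0 //.
apply: le_trans (ell2_psum_le a n.+1); rewrite big_nat_recr //= lerDr.
by apply: sumr_ge0 => k _; exact: sqr_ge0.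
Qed.

Let ell2_complete (F : set_system (ell2 V)) : ProperFilter F -> cauchy F -> cvg F.
Proof.
apply: rnorm_cauchy_complete => {}F PF cF.
have /choice[l Fl] : forall n, exists l : V, forall e : R, 0 < e ->
    ((fun a : ell2 V => a n) @ F) [set y | rnorm (l - y) < e].
  move=> n; apply: rnorm_complete => e e0; have [x Fx] := cF _ e0.
  exists (x n); rewrite /=; near=> y => /=.
  by apply: (le_lt_trans (ell2_coord_le (x - y) n)); near: y.
have approx (e : R) (x : ell2 V) : 0 < e -> F [set y | rnorm (x - y) < e] ->
    forall n, \sum_(0 <= k < n) rnorm (l k - x k) ^+ 2 <= (2 * e) ^+ 2.
  move=> e0 Fx n; pose d : R := e / n.+1%:R.
  have d0 : 0 < d by rewrite divr_gt0.
  have FI : F [set y : ell2 V | forall k : 'I_n, rnorm (l k - y k) < d].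
    by apply: filter_forall => k; exact: Fl.
  have [y [/= xy ly]] := filter_ex (filterI Fx FI).
  apply: (@le_trans _ _ (\sum_(0 <= k < n)
      (2 * d ^+ 2 + 2 * rnorm ((x - y : ell2 V) k) ^+ 2))).
    rewrite !big_mkord; apply: ler_sum => k _.
    have := rnormD (l k - y k) (y k - x k).
    rewrite addrA subrK [rnorm (y k - _)]rnormBC.
    have := ltW (ly k); have := rnorm_ge0 (l k - y k).
    have := rnorm_ge0 (l k - x k); have := rnorm_ge0 (x k - y k).
    rewrite -[(x - y : ell2 V) k]/(x k - y k).
    move: (rnorm _) (rnorm _) (rnorm _) => r q p p0 q0 r0 rd h.
    have h1 : q ^+ 2 <= (d + p) ^+ 2.
      by rewrite ler_pXn2r ?nnegrE ?addr_ge0 ?(ltW d0) //; lra.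
    have := sqr_ge0 (d - p); rewrite !expr2 in h1 *; nra.
  rewrite big_split /= sumr_const_nat subn0 -[(2 * d ^+ 2) *+ n]mulr_natl -mulr_sumr.
  have h1 : \sum_(0 <= k < n) rnorm ((x - y : ell2 V) k) ^+ 2 <= e ^+ 2.
    apply: le_trans (ell2_psum_le _ _) _.
    by rewrite ler_pXn2r ?nnegrE ?rnorm_ge0 ?ltW.
  have h2 : n%:R * d ^+ 2 <= e ^+ 2.
    rewrite /d expr_div_n mulrCA ger_pMr ?exprn_gt0 //.
    rewrite ler_pdivrMr ?exprn_gt0 // mul1r -natrX ler_nat.
    by rewrite (leq_trans (leqnSn n)) // -mulnn leq_pmulr.
  rewrite mulrCA; move: h1 h2; rewrite [(2 * e) ^+ 2]exprMn.
  move: (n%:R * _) (\sum_(_ <= _ < _) _) (e ^+ 2) => p q r; lra.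
have [x0 Fx0] := cF 1 ltr01.
have lP : l \in @ell2_pred R V.
  have -> : l = ((l - x0) : nat -> V) + x0 by rewrite subrK.
  rewrite rpredD ?(ell2P x0) //; apply/asboolP/square_summableP.
  by exists ((2 * 1) ^+ 2) => n; apply: (approx 1 x0).
exists (Ell2 lP) => e e0.
have e4 : 0 < e / 4 by rewrite divr_gt0.
have [x Fx] := cF _ e4; apply: filterS (Fx) => y /= xy.
have lx : rnorm (Ell2 lP - x) <= 2 * (e / 4).
  by apply: ell2_rnorm_le; [rewrite mulr_ge0 ?ltW|exact: (approx _ x e4 Fx)].
have := rnormD (Ell2 lP - x) (x - y); rewrite addrA subrK; lra.
Unshelve. all: by end_near. Qed.

HB.instance Definition _ := Uniform_isComplete.Build (ell2 V) ell2_complete.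

End Ell2.

Lemma Re_norm_ge0 (R : realType) (a : R[i]) : 0 <= complex.Re `|a|.
Proof. by rewrite -(@lecR R 0) (@RRe_real _ `|a|) ?normr_real ?normr_ge0. Qed.

Section ClosedRange.
Variables (R : realType) (V W : hilbertType R) (T : 'B(V, W)).

Let closed_range_submod : submod_closed (mem (closure (range T))).
Proof.
split; first by apply/mem_set/subset_closure; exists 0; rewrite ?linear0.
move=> a x y /set_mem/closure_rnorm Tx /set_mem/closure_rnorm Ty.
apply/mem_set/closure_rnorm => e e0.
pose d := complex.Re `|a|; have d0 : 0 <= d.
  exact: Re_norm_ge0.
have d1 : 0 < 2 * (d + 1) by rewrite mulr_gt0 // ltr_wpDl.
have [_ [u _ <-] xu] := Tx _ (divr_gt0 e0 d1).
have e2 : 0 < e / 2 by rewrite divr_gt0.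
have [_ [v _ <-] yv] := Ty _ e2.
exists (T (a *: u + v)); first by exists (a *: u + v).
rewrite linearP opprD addrACA -scalerBr; apply: (le_lt_trans (rnormD _ _)).
rewrite [ltRHS]splitr ler_ltD // rnormZC -/d.
apply: (@le_trans _ _ ((d + 1) * (e / (2 * (d + 1))))).
  by apply: ler_pM; rewrite ?rnorm_ge0 ?lerDl ?(ltW xu).
by rewrite le_eqVlt; apply/orP; left; apply/eqP; field; rewrite lt0r_neq0 // ltr_wpDl.
Qed.

Definition closed_range : closedSubspace W :=
  ClosedSubspace closed_range_submod (@closed_closure _ (range T)).

Let mem_closed_range x : T x \in csub_pred closed_range.
Proof. by apply/mem_set/subset_closure; exists x. Qed.

Definition to_range (x : V) : csub_type closed_range := CSub (mem_closed_range x).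

End ClosedRange.

Definition bop0 (R : realType) (V W : hilbertType R) : 'B(V, W) :=
  @Bop R V W \0 (@cst_continuous V W 0).

(* 0 <= inner (B x) x in R[i] says that inner (B x) x is real and nonnegative,
   so B is a positive (in particular selfadjoint) operator. *)
Definition is_psqrt (R : realType) (V : hilbertType R) (A : V -> V) (B : 'B(V)) :=
  (forall x, 0 <= inner (B x) x) /\ (forall x, B (B x) = A x).

(* A positive operator has exactly one positive square root; bop0 is a default
   value for other A.  For the defect operators of contractions, existence is
   defectP below. *)
Definition psqrt (R : realType) (V : hilbertType R) (A : V -> V) : 'B(V) :=
  if pselect (exists B, is_psqrt A B) is left ex then projT1 (cid ex) else bop0 V V.

(* Visser's iteration Y_0 = 0, Y_(n+1) = (X + Y_n^2) / 2, whose limit Y satisfies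
   (1 - Y)^2 = 1 - X.  poscomb s S: S is a polynomial in X with nonnegative
   coefficients of sum s. *)
Section SquareRoot.
Variables (R : realType) (V : hilbertType R) (X : V -> V).
Hypothesis XL : linear X.
Hypothesis X1 : forall x, rnorm (X x) <= rnorm x.
Hypothesis XX : forall x y, inner (X x) y = inner x (X y).

Inductive poscomb : R -> (V -> V) -> Prop :=
| poscomb0 : poscomb 0 (fun=> 0)
| poscombX : poscomb 1 X
| poscombD s t S T : poscomb s S -> poscomb t T ->
    poscomb (s + t) (fun x => S x + T x)
| poscombZ c s S : 0 <= c -> poscomb s S ->
    poscomb (c * s) (fun x => c%:C%C *: S x)
| poscombM s t S T : poscomb s S -> poscomb t T ->
    poscomb (s * t) (fun x => S (T x)).

Lemma poscomb_ge0 s S : poscomb s S -> 0 <= s.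
Proof.
by elim=> // *; rewrite ?addr_ge0 ?mulr_ge0.
Qed.

Lemma poscomb_linear s S : poscomb s S -> linear S.
Proof.
elim=> {s S} [a x y||s t S T _ SL _ TL a x y|c s S _ _ SL a x y|s t S T _ SL _ TL a x y].
- by rewrite scaler0 addr0.
- exact: XL.
- by rewrite SL TL scalerDr addrACA.
- by rewrite SL scalerDr !scalerA mulrC.
- by rewrite TL SL.
Qed.

Lemma linear_fun (S : V -> V) : linear S ->
  (forall x y, S (x + y) = S x + S y) * (forall a x, S (a *: x) = a *: S x) *
  (forall x y, S (x - y) = S x - S y).
Proof.
move=> SL; pose f : {linear V -> V} := HB.pack S (GRing.isLinear.Build _ V V _ S SL).
split; first split.
- exact: (raddfD f).
- by move=> a x; rewrite -[LHS]/(f (a *: x)) linearZ.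
- exact: (raddfB f).
Qed.

Lemma poscomb_le s S : poscomb s S -> forall x, rnorm (S x) <= s * rnorm x.
Proof.
elim=> {s S} [x||s t S T _ IS _ IT x|c s S c0 _ IS x|s t S T gS IS gT IT x].
- by rewrite rnorm0 mul0r.
- by move=> x; rewrite mul1r X1.
- by rewrite mulrDl (le_trans (rnormD _ _)) // lerD.
- by rewrite rnormZ ger0_norm // -mulrA ler_wpM2l.
- by rewrite (le_trans (IS _)) // -mulrA ler_wpM2l // (poscomb_ge0 gS).
Qed.

Lemma poscomb_comm (U : V -> V) : linear U -> (forall x, U (X x) = X (U x)) ->
  forall s S, poscomb s S -> forall x, U (S x) = S (U x).
Proof.
move=> UL UX; have [[UD UZ] _] := linear_fun UL.
move=> s S; elim=> {s S} [x||s t S T _ IS _ IT x|c s S _ _ IS x|s t S T _ IS _ IT x].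
- by rewrite -[0 in LHS](scale0r 0) UZ scale0r.
- exact: UX.
- by rewrite UD IS IT.
- by rewrite UZ IS.
- by rewrite IS IT.
Qed.

Lemma poscombC s t S T : poscomb s S -> poscomb t T ->
  forall x, S (T x) = T (S x).
Proof.
move=> gS gT; apply: (poscomb_comm _ _ gT); first exact: poscomb_linear gS.
by move=> x; rewrite (poscomb_comm XL _ gS).
Qed.

Lemma poscomb_sym s S : poscomb s S -> forall x y, inner (S x) y = inner x (S y).
Proof.
elim=> {s S} [x y||s t S T _ IS _ IT x y|c s S _ _ IS x y|s t S T gS IS gT IT x y].
- by rewrite inner0l inner0r.
- exact: XX.
- by rewrite innerDl innerDr IS IT.
- by rewrite innerZl innerZr IS; congr (_ * _); rewrite /Num.conj /= oppr0.
- by rewrite IS IT (poscombC gS gT).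
Qed.

Fixpoint sqrt_iter n (x : V) : V :=
  if n is m.+1 then (2^-1)%:C%C *: (X x + sqrt_iter m (sqrt_iter m x)) else 0.

Fixpoint sqrt_bound n : R :=
  if n is m.+1 then 2^-1 * (1 + sqrt_bound m * sqrt_bound m) else 0.

Local Notation Y := sqrt_iter.
Local Notation y_ := sqrt_bound.

Let half_ge0 : (0 : R) <= 2^-1. Proof. by rewrite invr_ge0. Qed.

Lemma poscomb_iter n : poscomb (y_ n) (Y n).
Proof.
elim: n => [|n IH]; first exact: poscomb0.
exact: (poscombZ half_ge0 (poscombD poscombX (poscombM IH IH))).
Qed.

Lemma sqrt_bound_le1 n : y_ n <= 1.
Proof.
elim: n => [|n IH] //=; have y0 := poscomb_ge0 (poscomb_iter n); nra.
Qed.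

Lemma poscomb_diff n : poscomb (y_ n.+1 - y_ n) (fun x => Y n.+1 x - Y n x).
Proof.
elim: n => [|n IH].
  have -> : y_ 1 - y_ 0 = 2^-1 * 1 by rewrite /= mul0r addr0 subr0.
  have -> : (fun x => Y 1 x - Y 0 x) = (fun x => (2^-1)%:C%C *: X x).
    by apply/funext => x /=; rewrite addr0 subr0.
  exact: (poscombZ half_ge0 poscombX).
have -> : y_ n.+2 - y_ n.+1 = 2^-1 * ((y_ n.+1 - y_ n) * (y_ n.+1 + y_ n)).
  rewrite [y_ n.+2]/= -[2^-1 * (1 + y_ n * y_ n)]/(y_ n.+1).
  have -> : y_ n.+1 = 2^-1 * (1 + y_ n * y_ n) by [].
  by field.
have -> : (fun x => Y n.+2 x - Y n.+1 x) = (fun x => (2^-1)%:C%C *: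
   ((Y n.+1 (Y n.+1 x + Y n x)) - Y n (Y n.+1 x + Y n x))).
  apply/funext => x.
  have [[D1 _] _] := linear_fun (poscomb_linear (poscomb_iter n.+1)).
  have [[D0 _] _] := linear_fun (poscomb_linear (poscomb_iter n)).
  rewrite D1 D0 (poscombC (poscomb_iter n) (poscomb_iter n.+1)).
  rewrite -[Y n.+2 x]/((2^-1)%:C%C *: (X x + Y n.+1 (Y n.+1 x))).
  rewrite -{3}[Y n.+1]/(fun x => (2^-1)%:C%C *: (X x + Y n (Y n x))).
  rewrite -scalerBr; congr (_ *: _).
  by rewrite opprD addrACA subrr add0r [in RHS]opprD addrA addrK.
exact: (poscombZ half_ge0 (poscombM IH (poscombD (poscomb_iter _) (poscomb_iter _)))).
Qed.

Lemma sqrt_iter_dist m n x : (n <= m)%N ->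
  rnorm (Y m x - Y n x) <= (y_ m - y_ n) * rnorm x.
Proof.
move=> /subnK <-; elim: (m - n)%N => [|k IH].
  by rewrite !subrr rnorm0 mul0r.
rewrite addSn -[Y _ x](subrK (Y (k + n) x)) -addrA (le_trans (rnormD _ _)) //.
rewrite -[y_ _.+1](subrK (y_ (k + n))) -[_ + _ - y_ n]addrA mulrDl lerD //.
exact: (poscomb_le (poscomb_diff _)).
Qed.

Lemma sqrt_iter_cvg x : exists l, forall e : R, 0 < e ->
  (Y ^~ x @ \oo) [set y | rnorm (l - y) < e].
Proof.
apply: rnorm_complete => e e0.
have yc : cvgn (y_ : nat -> R).
  apply: nondecreasing_is_cvgn.
    apply/nondecreasing_seqP => n.
    by rewrite -subr_ge0 (poscomb_ge0 (poscomb_diff n)).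
  by exists 1 => _ [n _ <-]; exact: sqrt_bound_le1.
have d0 : 0 < e / (rnorm x + 1) / 2.
  by rewrite !divr_gt0 // ltr_wpDl // rnorm_ge0.
have /cvgrPdist_lt/(_ _ d0) [N _ NP] := yc.
exists (Y N x); exists N => // n /= Nn.
rewrite rnormBC (le_lt_trans (sqrt_iter_dist x Nn)) //.
have h : y_ n - y_ N <= e / (rnorm x + 1).
  have := NP _ Nn; have := NP _ (leqnn N); rewrite /= !ltr_norml.
  move=> /andP[_ h1] /andP[h2 _]; rewrite [leRHS]splitr; lra.
apply: (@le_lt_trans _ _ (e / (rnorm x + 1) * rnorm x)).
  by rewrite ler_wpM2r ?rnorm_ge0.
rewrite mulrAC ltr_pdivrMr; last by rewrite ltr_wpDl ?rnorm_ge0.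
by rewrite ltr_pM2l // ltrDl.
Qed.

Lemma ex_psqrt : exists B : 'B(V), is_psqrt (fun x => x - X x) B.
Proof.
have /choice[Z ZP] := sqrt_iter_cvg.
have near_eq (x u : V) : (forall e : R, 0 < e -> rnorm (x - u) <= e) -> x = u.
  move=> h; apply/eqP; rewrite -subr_eq0; apply/eqP/rnorm_eq0.
  apply/eqP; rewrite eq_le rnorm_ge0 andbT; apply/ler_addgt0Pr => e e0.
  by rewrite add0r h.
have Zlim (x : V) (e : R) : 0 < e ->
    exists N, forall n, (N <= n)%N -> rnorm (Z x - Y n x) < e.
  by move=> e0; have [N _ NP] := ZP x _ e0; exists N.
have Y1 n x : rnorm (Y n x) <= rnorm x.
  rewrite (le_trans (poscomb_le (poscomb_iter n) x)) // ler_piMl ?rnorm_ge0 //.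
  exact: sqrt_bound_le1.
have Z1 x : rnorm (Z x) <= rnorm x.
  apply/ler_addgt0Pr => e e0; have [n /(_ n (leqnn n)) Zn] := Zlim x _ e0.
  rewrite -[Z x](subrK (Y n x)) (le_trans (rnormD _ _)) //.
  by rewrite [leLHS]addrC lerD // ltW.
have ZL : linear Z.
  move=> a x u; apply: near_eq => e e0.
  pose d := complex.Re `|a|; have d0 : 0 <= d.
    exact: Re_norm_ge0.
  have e3 : 0 < e / (d + 2) by rewrite divr_gt0 // ltr_wpDl.
  have [N1 N1P] := Zlim (a *: x + u) _ e3; have [N2 N2P] := Zlim x _ e3.
  have [N3 N3P] := Zlim u _ e3; pose n := (N1 + N2 + N3)%N.
  have h1 : rnorm (Z (a *: x + u) - Y n (a *: x + u)) < e / (d + 2).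
    by apply: N1P; rewrite /n -addnA leq_addr.
  have h2 : rnorm (Z x - Y n x) < e / (d + 2).
    by apply: N2P; rewrite /n addnAC leq_addl.
  have h3 : rnorm (Z u - Y n u) < e / (d + 2) by apply: N3P; exact: leq_addl.
  have -> : Z (a *: x + u) - (a *: Z x + Z u) = (Z (a *: x + u) - Y n (a *: x + u))
     - (a *: (Z x - Y n x) + (Z u - Y n u)).
    rewrite (poscomb_linear (poscomb_iter n)) scalerBr.
    by rewrite [in RHS]addrACA -opprD opprB addrA subrK.
  apply: (le_trans (rnormD _ _)); rewrite rnormN.
  have h4 := rnormD (a *: (Z x - Y n x)) (Z u - Y n u).
  rewrite rnormZC -/d in h4.
  have h5 : d * rnorm (Z x - Y n x) <= d * (e / (d + 2)).
    by rewrite ler_wpM2l // ltW.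
  have -> : e = e / (d + 2) + (d * (e / (d + 2)) + e / (d + 2)).
    by field; rewrite lt0r_neq0 // ltr_wpDl.
  by apply: lerD; [exact: ltW|apply: (le_trans h4); rewrite lerD // ltW].
have [[ZD ZZ] ZB] := linear_fun ZL.
have ZE x : X x = 2%:C%C *: Z x - Z (Z x).
  apply: near_eq => e e0; have e4 : 0 < e / 4 by rewrite divr_gt0.
  have [N1 N1P] := Zlim x _ e4; have [N2 N2P] := Zlim (Z x) _ e4.
  pose n := maxn N1 N2.
  have h1 : rnorm (Z x - Y n.+1 x) < e / 4 := N1P n.+1 (leqW (leq_maxl _ _)).
  have h2 : rnorm (Z x - Y n x) < e / 4 := N1P n (leq_maxl _ _).
  have h3 : rnorm (Z (Z x) - Y n (Z x)) < e / 4 := N2P n (leq_maxr _ _).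
  have YB := (linear_fun (poscomb_linear (poscomb_iter n))).2.
  have -> : X x - (2%:C%C *: Z x - Z (Z x)) =
     - (2%:C%C *: (Z x - Y n.+1 x)) + ((Z (Z x) - Y n (Z x)) + Y n (Z x - Y n x)).
    have -> : X x = 2%:C%C *: Y n.+1 x - Y n (Y n x).
      by rewrite /= scalerA -rmorphM /= divff ?pnatr_eq0 // scale1r addrK.
    rewrite YB [Z (Z x) - _ + _]addrA subrK scalerBr !opprB.
    by rewrite [Z (Z x) - 2%:C%C *: _]addrC addrACA [- _ + Z _]addrC.
  apply: (le_trans (rnormD _ _)); rewrite rnormN rnormZ ger0_norm //.
  have := rnormD (Z (Z x) - Y n (Z x)) (Y n (Z x - Y n x)).
  have := Y1 n (Z x - Y n x); lra.
have Zreal x : complex.Im (inner (Z x) x) = 0.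
  apply/eqP; rewrite -normr_eq0 eq_le normr_ge0 andbT.
  apply/ler_addgt0Pr => e e0; rewrite add0r.
  have x1 : 0 < rnorm x + 1 by rewrite ltr_wpDl ?rnorm_ge0.
  have [n /(_ n (leqnn n)) Zn] := Zlim x _ (divr_gt0 e0 x1).
  have Yr : complex.Im (inner (Y n x) x) = 0.
    have := inner_conj (Y n x) x; rewrite -(poscomb_sym (poscomb_iter n)).
    by case: (inner _ _) => u v /= [] /eqP; rewrite -addr_eq0 -mulr2n mulrn_eq0 => /eqP.
  have -> : complex.Im (inner (Z x) x) = complex.Im (inner (Z x - Y n x) x).
    by rewrite innerDl innerNl raddfB /= Yr subr0.
  rewrite -(@lecR R); apply: le_trans (normc_ge_Im _) _.
  apply: le_trans (inner_CS _ _) _; rewrite !rnormE -rmorphM lecR.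
  apply: (@le_trans _ _ (e / (rnorm x + 1) * (rnorm x + 1))).
    by rewrite ler_pM ?rnorm_ge0 ?lerDl // ltW.
  by rewrite divfK ?lt0r_neq0.
pose f x := x - Z x.
have fL : linear f by move=> a x u; rewrite /f ZL scalerBr opprD addrACA.
have f2 x : rnorm (f x) <= 2 * rnorm x.
  by have := rnormD x (- Z x); rewrite rnormN /f; have := Z1 x; lra.
have [B BE] := bop_of fL f2; exists B; split=> x; rewrite !BE /f.
  rewrite lecE /= innerDl innerNl !raddfB /= Zreal.
  rewrite inner_norm rnormE -rmorphXn /= subr0 eqxx /= subr_ge0.
  rewrite -[complex.Re (inner _ _)]/(rinner (Z x) x).
  apply: le_trans (ler_norm _) _; apply: le_trans (rinner_CS _ _) _.
  by rewrite expr2 ler_wpM2r ?rnorm_ge0.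
rewrite ZB ZE -[2]/(1 + 1) rmorphD /= scalerDl scale1r !opprB.
by rewrite opprD !addrA; congr (_ + _); rewrite addrAC.
Qed.

End SquareRoot.

Definition defect (R : realType) (V : hilbertType R) (T : 'B(V)) : 'B(V) :=
  psqrt (fun x => x - adj T (T x)).

Lemma defectP (R : realType) (V : hilbertType R) (T : 'B(V)) :
  (forall x, rnorm (T x) <= rnorm x) ->
  is_psqrt (fun x => x - adj T (T x)) (defect T).
Proof.
move=> T1.
have [|||B BP] := @ex_psqrt R V (fun x => adj T (T x)).
- by move=> a x y; rewrite !linearP.
- move=> x; have [/rnorm_eq0->|x0] := eqVneq (rnorm (adj T (T x))) 0.
    by rewrite rnorm0 rnorm_ge0.
  have x1 : 0 < rnorm (adj T (T x)) by rewrite lt_def x0 rnorm_ge0.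
  rewrite -(ler_pM2l x1) -expr2 -rinnerxx /rinner -adjP.
  apply: le_trans (ler_norm _) _; apply: le_trans (rinner_CS _ _) _.
  by rewrite ler_pM ?rnorm_ge0.
- by move=> x y; rewrite inner_conj -adjP -inner_conj -adjP.
rewrite /defect /psqrt; case: pselect => [ex|[]]; last by exists B.
exact: (projT2 (cid ex)).
Qed.

Section GammaContractions.
Variables (R : realType) (V : hilbertType R).
Local Notation C := R[i].
Implicit Types (S P T U : V -> V).

Definition Gamma : set (C * C) :=
  [set (z.1 + z.2, z.1 * z.2) | z in [set z : C * C | `|z.1| <= 1 /\ `|z.2| <= 1]].

Definition bGamma : set (C * C) :=
  [set (z.1 + z.2, z.1 * z.2) | z in [set z : C * C | `|z.1| = 1 /\ `|z.2| = 1]].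

(* A polynomial f(s, p) is seen as a polynomial in s with coefficients
   polynomials in p. *)
Definition poly_eval (f : {poly {poly C}}) S P (x : V) : V :=
  \sum_(i < size f) \sum_(j < size f`_i) f`_i`_j *: iter i S (iter j P x).

Definition opnorm T : R := sup [set rnorm (T x) | x in [set x | rnorm x <= 1]].

Definition gamma_contraction (S P : 'B(V)) : Prop :=
  (forall x, S (P x) = P (S x)) /\
  forall f : {poly {poly C}}, opnorm (poly_eval f S P) <=
    sup [set complex.Re `|f.[w.1%:P].[w.2]| | w in Gamma].

Definition normal_op (T : 'B(V)) : Prop := forall x, adj T (T x) = T (adj T x).

(* Exactness of the Koszul complex 0 -> V -> V (+) V -> V -> 0 of the pair
   (S, T); the joint spectrum is Taylor's. *)
Definition koszul_exact S T : Prop :=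
  [/\ forall x, S x = 0 -> T x = 0 -> x = 0,
      forall x y, S y = T x -> exists z, x = S z /\ y = T z &
      forall y, exists x1 x2, y = S x1 + T x2].

Definition joint_spectrum S T : set (C * C) :=
  [set w | ~ koszul_exact (fun x => S x - w.1 *: x) (fun x => T x - w.2 *: x)].

Definition gamma_unitary (T U : 'B(V)) : Prop :=
  [/\ forall x, T (U x) = U (T x), normal_op T, normal_op U &
      joint_spectrum T U `<=` bGamma].

Definition zpow (U : 'B(V)) (n : int) (x : V) : V :=
  match n with Posz k => iter k U x | Negz k => iter k.+1 (adj U) x end.

Definition closed_span (A : set V) : set V :=
  closure [set x | exists n (c : 'I_n -> C) (v : 'I_n -> V),
    (forall i, A (v i)) /\ x = \sum_(i < n) c i *: v i].

End GammaContractions.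

Section Dilations.
Variables (R : realType) (H K : hilbertType R) (J : 'B(H, K)).

(* H is identified with a subspace of K through the isometry J; the
   orthogonal projection of K onto H is then the adjoint of J. *)
Definition gamma_unitary_dilation (S P : 'B(H)) (T U : 'B(K)) : Prop :=
  [/\ forall h, `|J h| = `|h|, gamma_unitary T U &
      forall m n h, iter m S (iter n P h) = adj J (iter m T (iter n U (J h)))].

(* For a commuting pair of normal operators. *)
Definition minimal_dilation (N1 N2 : 'B(K)) : Prop :=
  closed_span [set x | exists k1 k2 l1 l2 h,
    x = iter k1 N1 (iter k2 N2 (iter l1 (adj N1) (iter l2 (adj N2) (J h))))]
  = setT.

End Dilations.

Section Fundamental.
Variables (R : realType) (H : hilbertType R).

Definition defect_space (P : 'B(H)) : hilbertType R :=
  csub_type (closed_range (defect P)).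

(* D_P h as an element of the space of P, the closure of the range of D_P. *)
Definition defect_to (P : 'B(H)) (h : H) : defect_space P :=
  to_range (defect P) h.

Definition fundamental_operator (S P : 'B(H)) (F : 'B(defect_space P)) : Prop :=
  forall h, S h - adj S (P h) = defect P (csub_val (F (defect_to P h))).

Variable P : 'B(H).

Definition dilation_space : hilbertType R :=
  hsum (hsum H (ell2 (defect_space P))) (ell2 (defect_space (adj P))).

Definition embed (h : H) : dilation_space := ((h, 0), 0).

Let embed_linear : linear embed.
Proof.
move=> a x y.
have e0 (W : lmodType R[i]) : 0 = a *: (0 : W) + 0 by rewrite scaler0 addr0.
rewrite /embed [in LHS](e0 (ell2 (defect_space P))).
by rewrite [in LHS](e0 (ell2 (defect_space (adj P)))).
Qed.

HB.instance Definition _ := GRing.isLinear.Build R[i] H dilation_space _ embed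
  embed_linear.

Lemma rnorm_embed h : rnorm (embed h) = rnorm h.
Proof.
apply/eqP; rewrite -(@eqrXn2 _ 2%N) ?rnorm_ge0 // !hsum_rnorm /=.
by rewrite !rnorm0 expr0n !addr0.
Qed.

Let embed_continuous : continuous embed.
Proof.
by apply: (@bounded_continuous _ _ _ _ 1) => [x y|x];
  rewrite ?raddfB // rnorm_embed mul1r.
Qed.

Definition embedding : 'B(H, dilation_space) := Bop embed_continuous.

End Fundamental.

Lemma gamma_contraction_le (R : realType) (V : hilbertType R) (S P : 'B(V)) :
  gamma_contraction S P -> forall x, rnorm (P x) <= rnorm x.
Proof.
move=> [_ /(_ ('X%:P))].
have -> : poly_eval 'X%:P S P = P.
  apply/funext => x; rewrite /poly_eval size_polyC polyX_eq0 /= big_ord1.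
  rewrite coefC /= size_polyX big_ord_recl big_ord1 !coefX /=.
  by rewrite scale0r add0r scale1r.
have supG : sup [set complex.Re `|('X%:P : {poly {poly R[i]}}).[w.1%:P].[w.2]| |
    w in @Gamma R] <= 1.
  apply: ge_sup; first by exists (complex.Re `|('X%:P : {poly {poly R[i]}}).[0%:P].[0]|);
    exists (0, 0) => //; exists (0, 0); rewrite /= ?normr0 ?addr0 ?mul0r.
  move=> _ [_ [[z1 z2] [z11 z21] <-] <-]; rewrite hornerC hornerX.
  have : `|z1 * z2| <= 1 by rewrite normrM mulr_ile1.
  by rewrite -[`|z1 * z2|]RRe_real ?normr_real // (@lecR R _ 1).
move=> /le_trans/(_ supG) P1 x.
have [M M0 PM] := bop_bounded P.
have [/rnorm_eq0->|x0] := eqVneq (rnorm x) 0; first by rewrite linear0 rnorm0.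
have x1 : 0 < rnorm x by rewrite lt_def x0 rnorm_ge0.
have nx : rnorm ((rnorm x)^-1%:C%C *: x) = 1.
  by rewrite rnormZ ger0_norm ?invr_ge0 ?rnorm_ge0 // mulVf.
have : rnorm (P ((rnorm x)^-1%:C%C *: x)) <= 1.
  apply: le_trans P1; apply: ub_le_sup.
    by exists M => _ [y /= y1 <-]; rewrite (le_trans (PM _)) // ler_piMr.
  by exists ((rnorm x)^-1%:C%C *: x) => //=; rewrite nx.
by rewrite linearZ rnormZ ger0_norm ?invr_ge0 ?rnorm_ge0 // mulrC ler_pdivrMr // mul1r.
Qed.

(* Main.v *)
Require Import Defs.
From mathcomp Require Import all_boot all_order all_algebra.
From mathcomp Require Import all_classical all_reals topology normedtype.
From mathcomp Require Import sequences complex ring.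
Import Order.TTheory GRing.Theory Num.Theory.
Import numFieldNormedType.Exports.
Local Open Scope classical_set_scope.
Local Open Scope ring_scope.

(** The vectors U^n h, with h in H and n an integer, already span a dense
    subspace of K (orbit_total); both spans in the theorem contain these
    vectors, so both are the whole of K.

    Density is checked on the orthogonal complement (closed_span_total).  Let
    k = h (+) a (+) b be orthogonal to every U^n g.  Orthogonality to the
    vectors U*^m g, where U* is the adjoint of U and m >= 0, says that the
    H-component of U^m k vanishes for all m.  In particular h = 0.  Since U shifts b to the left and feeds
    D_{P*} b_0 into H, it follows that D_{P*} b_n = 0 for all n, and
    D_{P*} is injective on the closure of its range, so b = 0
    (iter_orth_b).  In the other direction, the l^2(D_P)-component of
    U^(n+1) g is D_P g in position n (iter_embed_a_last) and 0 beyond it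
    (iter_embed_a), so that, once a_i = 0 for i < n, orthogonality to
    U^(n+1) g says that a_n is orthogonal to D_P g for every g; hence
    a_n = 0. *)

Section Density.
Variables (R : realType) (V : hilbertType R).
Implicit Types A B : set V.

Lemma closure_submod A :
  submod_closed (mem A) -> submod_closed (mem (closure A)).
Proof.
move=> [A0 AL]; split; first exact/mem_set/subset_closure/set_mem.
move=> c x y /set_mem/closure_rnorm xA /set_mem/closure_rnorm yA.
apply/mem_set/closure_rnorm => e e0.
pose d := complex.Re `|c|.
have d1 : 0 < d + 1 by rewrite ltr_wpDl // Re_norm_ge0.
have e2 : 0 < e / 2 by rewrite divr_gt0.
(* |c| may vanish, hence the denominator |c| + 1. *)
have [u Au xu] := xA _ (divr_gt0 e2 d1).
have [v Av yv] := yA _ e2.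
exists (c *: u + v); first by apply/set_mem/AL; exact/mem_set.
rewrite opprD addrACA -scalerBr; apply: (le_lt_trans (rnormD _ _)).
rewrite [ltRHS]splitr ler_ltD // rnormZC -/d.
rewrite (@le_trans _ _ ((d + 1) * (e / 2 / (d + 1)))) //.
  by apply: ler_pM; rewrite ?rnorm_ge0 ?Re_norm_ge0 ?lerDl // ltW.
by rewrite mulrC divfK // lt0r_neq0.
Qed.

Lemma closed_span_submod A : submod_closed (mem (closed_span A)).
Proof.
apply: closure_submod; split.
  apply/mem_set; exists 0%N, (fun=> 0), (fun=> 0); split; first by case.
  by rewrite big_ord0.
move=> a _ _ /set_mem[n [c [v [Av ->]]]] /set_mem[m [d [w [Aw ->]]]].
apply/mem_set.
exists (n + m)%N,
  (fun i : 'I_(n + m) => match fintype.split i with inl j => a * c j | inr j => d j end),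
  (fun i : 'I_(n + m) => match fintype.split i with inl j => v j | inr j => w j end).
split=> [i|]; first by case: fintype.split.
rewrite big_split_ord scaler_sumr /=; congr (_ + _); apply: eq_bigr => i _.
  by rewrite (unsplitK (inl i)) scalerA.
by rewrite (unsplitK (inr i)).
Qed.

Lemma sub_closed_span A : A `<=` closed_span A.
Proof.
move=> x Ax; apply: subset_closure; exists 1%N, (fun=> 1), (fun=> x).
by rewrite big_ord1 scale1r.
Qed.

Lemma closed_spanS A B : A `<=` B -> closed_span A `<=` closed_span B.
Proof.
move=> AB; apply: closure_subset => x [n [c [v [Av ->]]]].
by exists n, c, v; split=> // i; exact/AB.
Qed.

(** Riesz representation in the closed span of A yields the orthogonal
    projection p of x onto it; then x - p is orthogonal to A, so x = p. *)
Lemma closed_span_total A :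
  (forall k, (forall x, A x -> inner k x = 0) -> k = 0) -> closed_span A = setT.
Proof.
move=> A0; apply/seteqP; split=> // x _.
pose W := ClosedSubspace (closed_span_submod A) (@closed_closure _ _).
have [p pP] : exists p : csub_type W, forall y, inner (csub_val y) x = inner y p.
  apply: (@riesz _ _ _ (rnorm x)) => [a y z|y].
    by rewrite -[csub_val (_ + _)]/(val (a *: y + z)) linearP innerDl innerZl.
  rewrite (le_trans (inner_CS _ _)) // !rnormE -rmorphM lecR mulrC.
  by rewrite csub_rnorm.
suff -> : x = csub_val p by exact/set_mem/(csub_valP p).
apply/eqP; rewrite -subr_eq0; apply/eqP/A0 => y Ay.
have Wy : y \in csub_pred W by apply/mem_set/sub_closed_span.
rewrite inner_conj innerDr innerNr (pP (CSub Wy)).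
by rewrite [inner (CSub Wy) p]/(inner y (csub_val p)) subrr rmorph0.
Qed.

End Density.

Section DefectOperators.
Variables (R : realType) (V : hilbertType R).

(** Polarization: the sesquilinear form t x y = <B x, y> - <x, B y> vanishes on
    the diagonal, so it is antisymmetric; comparing y with i y shows that it is
    also symmetric. *)
Lemma selfadjoint_of_nonneg (B : 'B(V)) :
  (forall x, 0 <= inner (B x) x) -> forall x y, inner (B x) y = inner x (B y).
Proof.
move=> B0 x y; apply/eqP; rewrite -subr_eq0; apply/eqP.
pose t u v := inner (B u) v - inner u (B v).
have t0 u : t u u = 0.
  by rewrite /t [inner u _]inner_conj (geC0_conj (B0 u)) subrr.
have tD u v : t u v + t v u = 0.
  have : t (u + v) (u + v) = t u u + (t u v + t v u) + t v v.
    by rewrite /t linearD !innerDl !innerDr; ring.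
  by rewrite !t0 add0r addr0.
have tC : t y x = - t x y by apply/eqP; rewrite -addr_eq0 tD.
have := tD x ('i%C *: y); rewrite -[inner (B x) y - _]/(t x y).
have -> : t x ('i%C *: y) = 'i%C^* * t x y.
  by rewrite /t linearZ !innerZr mulrBr.
have -> : t ('i%C *: y) x = 'i%C * t y x.
  by rewrite /t linearZ !innerZl mulrBr.
have -> : 'i%C^* = - 'i%C :> R[i] by apply/eqP; rewrite eq_complex /= oppr0 !eqxx.
rewrite tC mulrN mulNr -opprD => /eqP; rewrite oppr_eq0 -mulr2n mulrn_eq0 /=.
by rewrite mulf_eq0 eq_complex /= oner_eq0 andbF => /eqP.
Qed.

(** The defect operator is chosen by psqrt: it is either positive or the default
    value 0, and it is selfadjoint in both cases. *)
Lemma defect_selfadjoint (T : 'B(V)) x y :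
  inner (defect T x) y = inner x (defect T y).
Proof.
rewrite /defect /psqrt; case: pselect => [ex|_]; last by rewrite inner0l inner0r.
by apply: selfadjoint_of_nonneg; exact: (proj1 (projT2 (cid ex))).
Qed.

(** The defect space is by definition the closure of the range: approximating a
    itself by some D_T h within e gives |a|^2 = <a, a - D_T h> <= |a| e. *)
Lemma defect_to_total (T : 'B(V)) (a : defect_space T) :
  (forall h, inner a (defect_to T h) = 0) -> a = 0.
Proof.
move=> aD; apply/rnorm_eq0/eqP; rewrite eq_le rnorm_ge0 andbT.
apply/ler_addgt0Pr => e e0; rewrite add0r.
have /closure_rnorm/(_ _ e0)[_ [h _ <-] ae] := set_mem (csub_valP a).
have aa : rnorm a ^+ 2 <= rnorm a * rnorm (a - defect_to T h).
  apply: le_trans (rinner_CS _ _); apply: le_trans (ler_norm _).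
  by rewrite /rinner innerDr innerNr aD subr0 -rinnerxx.
have [->|a0] := eqVneq (rnorm a) 0; first exact: ltW.
rewrite expr2 ler_pM2l ?lt_def ?a0 ?rnorm_ge0 // in aa.
by apply: (le_trans aa); rewrite csub_rnorm linearB ltW.
Qed.

(** The kernel of a selfadjoint operator is orthogonal to its range. *)
Lemma defect_inj (T : 'B(V)) (a : defect_space T) :
  defect T (csub_val a) = 0 -> a = 0.
Proof.
move=> Da; apply: defect_to_total => h.
rewrite -[LHS]/(inner (csub_val a) (defect T h)).
by rewrite -defect_selfadjoint Da inner0l.
Qed.

End DefectOperators.

Section OrthogonalSums.
Variables (R : realType) (V : hilbertType R).

Lemma hsum_innerE (W : hilbertType R) (x y : hsum V W) :
  inner x y = inner x.1 y.1 + inner x.2 y.2.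
Proof. by []. Qed.

Lemma ell2_inner_single (a b : ell2 V) m :
  (forall i, i != m -> inner (a i) (b i) = 0) ->
  inner a b = inner (a m) (b m).
Proof.
move=> ab; rewrite -[LHS]/(ell2_inner a b).
apply: (@cvg_lim R[i]^o (@norm_hausdorff _ R[i]^o)).
apply: cvg_near_cst; exists m.+1 => // n /= mn.
by rewrite /series /= (bigD1_seq m) ?iota_uniq ?mem_index_iota //= big1 ?addr0.
Qed.

End OrthogonalSums.

Section SchaefferDilation.
Variables (R : realType) (H : hilbertType R) (P : 'B(H)).
Local Notation K := (dilation_space P).
Variable U : 'B(K).
Hypothesis hU : forall (h : H) (a : ell2 (defect_space P))
    (b : ell2 (defect_space (adj P))),
  let k := U ((h, a), b) in
  [/\ k.1.1 = P h + defect (adj P) (csub_val (b 0%N)),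
      csub_val (k.1.2 0%N) = defect P h - adj P (csub_val (b 0%N)),
      forall n, k.1.2 n.+1 = a n &
      forall n, k.2 n = b n.+1].

Let orbit : set K := [set x | exists (n : int) h, x = zpow U n (embedding P h)].

Lemma iter_embed_a n h i :
  (n <= i)%N -> (iter n U (embedding P h)).1.2 i = 0.
Proof.
elim: n i => [|n IH] [|i] //=.
by case: (iter n U _) IH => [[g a] b] IH; have [_ _ -> _] := hU g a b; exact: IH.
Qed.

(** D_P h enters at position 0 on the first application of U and is then moved
    one place to the right by each further one. *)
Lemma iter_embed_a_last n h :
  (iter n.+1 U (embedding P h)).1.2 n = defect_to P h.
Proof.
elim: n => [|n IH].
  apply: val_inj; have [_ e _ _] := hU h 0 0.
  by apply: (etrans e); rewrite linear0 subr0.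
rewrite iterS; case: (iter n.+1 U _) IH => [[g a] b] /= <-.
by have [_ _ -> _] := hU g a b.
Qed.

(** The H-component of U k is P h + D_{P*} b_0; with h = 0 its vanishing gives
    D_{P*} b_0 = 0.  The coordinate b_(n+1) of k is the coordinate b_n of U k,
    which satisfies the same hypothesis. *)
Lemma iter_orth_b (k : K) n : (forall m, (iter m U k).1.1 = 0) -> k.2 n = 0.
Proof.
elim: n k => [|n IH] [[h a] b] k0.
  have [e _ _ _] := hU h a b.
  by apply: defect_inj; move: e; rewrite (k0 1%N) (k0 0%N : h = 0) linear0 add0r.
have [_ _ _ <-] := hU h a b.
by apply: IH => m; rewrite -iterSr k0.
Qed.

(** Powers of the adjoint of U move to the other side of the inner product, so
    orthogonality to U^n g for n < 0 becomes a statement on the H-component of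
    the iterates of U at k; n >= 0 then settles a coordinate by coordinate. *)
Lemma orbit_total : closed_span orbit = setT.
Proof.
apply: closed_span_total => -[[h a] b] orth.
have orthn n g : inner ((h, a, b) : K) (iter n U (embedding P g)) = 0.
  by apply: orth; exists (Posz n), g.
have adj_iter n (x y : K) : inner x (iter n (adj U) y) = inner (iter n U x) y.
  by elim: n x => [|n IH] x //=; rewrite -adjP IH -iterSr.
have k0 m : (iter m U ((h, a, b) : K)).1.1 = 0.
  apply: inner_eq0; set y := (iter m U _).1.1.
  have <- : inner (iter m U ((h, a, b) : K)) (embedding P y) = inner y y.
    by rewrite !hsum_innerE /= !inner0r !addr0.
  rewrite -adj_iter; apply: orth; case: m @y => [|m] y.
    by exists 0%Z, y.
  by exists (Negz m), y.
have h0 : h = 0 := k0 0%N.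
have b0 : b = 0 by apply/val_inj/funext => n; exact: (@iter_orth_b (h, a, b)).
have a0 : a = 0.
  apply/val_inj/funext => n /=; elim/ltn_ind: n => n an.
  apply: defect_to_total => g; rewrite -(orthn n.+1 g).
  rewrite !hsum_innerE /= h0 b0 !inner0l add0r addr0.
  rewrite -(iter_embed_a_last n g); symmetry; apply: ell2_inner_single => i.
  case: ltngtP => // [/an ->|ni] _; first by rewrite inner0l.
  by rewrite [X in inner _ X](iter_embed_a n.+1 g i ni) inner0r.
by rewrite h0 a0 b0.
Qed.

End SchaefferDilation.

Theorem mainTheorem3 (RT : realType) (H : hilbertType RT) (S P : 'B(H))
    (hSP : gamma_contraction S P)
    (F : 'B(defect_space P)) (hF : fundamental_operator S F)
    (G : 'B(defect_space (adj P))) (hG : fundamental_operator (adj S) G)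
    (R U : 'B(dilation_space P))
    (hRU : gamma_unitary_dilation (embedding P) S P R U)
    (hU : forall (h : H) (a : ell2 (defect_space P))
                 (b : ell2 (defect_space (adj P))),
      let k := U ((h, a), b) in
      [/\ k.1.1 = P h + defect (adj P) (csub_val (b 0%N)),
          csub_val (k.1.2 0%N) = defect P h - adj P (csub_val (b 0%N)),
          forall n, k.1.2 n.+1 = a n &
          forall n, k.2 n = b n.+1])
    (hR : forall (h : H) (a : ell2 (defect_space P))
                 (b : ell2 (defect_space (adj P))),
      let k := R ((h, a), b) in
      [/\ k.1.1 = S h + defect (adj P) (csub_val (G (b 0%N))),
          csub_val (k.1.2 0%N) =
            csub_val (adj F (defect_to P h)) + csub_val (F (a 0%N))
            - adj P (csub_val (G (b 0%N))),
          forall n, k.1.2 n.+1 = adj F (a n) + F (a n.+1) &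
          forall n, k.2 n = adj G (b n) + G (b n.+1)]) :
  minimal_dilation (embedding P) R U /\
  closed_span [set x | exists m1 m2 (n : int) h,
      x = iter m1 R (iter m2 (adj R) (zpow U n (embedding P h)))]
  = closed_span [set x | exists (n : int) h, x = zpow U n (embedding P h)].
Proof.
have dense := orbit_total _ _ _ _ hU.
have full (A : set (dilation_space P)) :
    [set x | exists (n : int) h, x = zpow U n (embedding P h)] `<=` A ->
    closed_span A = setT.
  move=> oA; apply/seteqP; split=> //; rewrite -dense; exact: closed_spanS.
split.
  apply: full => _ [[n|n] [h ->]].
    by exists 0%N, n, 0%N, 0%N, h.
  by exists 0%N, 0%N, 0%N, n.+1, h.
rewrite dense; apply: full => _ [n [h ->]].
by exists 0%N, 0%N, n, h.
Qed.
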